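(* $\mathrm{CFL}\subset\mathcal{L}(\mathrm{IND}_{\mathrm{LIN}})\subset\mathcal{L}(\mathrm{IND}_{\mathrm{UFIN}_1})\subseteq\mathcal{L}(\mathrm{IND}_{\mathrm{UFIN}})\subset\mathcal{L}(\mathrm{IND}_{\mathrm{FIN}})$, where $\subset$ denotes strict inclusion.
   Context: $\mathrm{CFL}$ is the family of context-free languages. An indexed grammar is a 5-tuple $G=(V,T,I,P,S)$ where $V,T,I$ are finite pairwise disjoint sets (variables, terminals, indices), $S\in V$ is the start variable, and $P$ is a finite set of productions of the forms (1) $A\to\nu$, (2) $A\to Bf$, (3) $Af\to\nu$, with $A,B\in V$, $f\in I$, $\nu\in(V\cup T)^*$. Sentential forms are words in $(VI^*\cup T)^*$. In one derivation step $\Rightarrow$, an occurrence $A\alpha$ in a sentential form ($A\in V$, $\alpha\in I^*$ the maximal word of indices following it) is replaced as follows: by (1) $A\to w_1C_1\cdots w_\ell C_\ell w_{\ell+1}$ ($w_j\in T^*$, $C_j\in V$), it is replaced by $w_1C_1\alpha\cdots w_\ell C_\ell\alpha w_{\ell+1}$; by (2) $A\to Bf$, it is replaced by $Bf\alpha$; by (3) $Af\to w_1C_1\cdots w_\ell C_\ell w_{\ell+1}$, if $\alpha=f\alpha'$, it is replaced by $w_1C_1\alpha'\cdots w_\ell C_\ell\alpha' w_{\ell+1}$. The generated language is $L(G)=\{u\in T^*: S\Rightarrow^* u\}$. A successful derivation is a derivation from $S$ of a word of $L(G)$. - $\mathcal{L}(\mathrm{IND}_{\mathrm{LIN}})$: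 languages generated by linear indexed grammars, i.e. those in which the right-hand side of every production contains at most one variable. - $\mathcal{L}(\mathrm{IND}_{\mathrm{UFIN}_1})$: languages generated by indexed grammars such that in every successful derivation there is at most one application of a special production, a production being special if its right-hand side contains at least 2 occurrences of variables. - $\mathcal{L}(\mathrm{IND}_{\mathrm{UFIN}})$: languages generated by uncontrolled finite-index grammars, i.e. grammars for which there is $k\ge1$ such that in every successful derivation every sentential form contains at most $k$ occurrences of variables. - $\mathcal{L}(\mathrm{IND}_{\mathrm{FIN}})$: languages generated by finite-index grammars, i.e. grammars for which there is $k\ge1$ such that every $u\in L(G)$ has some derivation from $S$ in which every sentential form contains at most $k$ occurrences of variables. *)

(* Defs.v *)
From HB Require Import structures.
From mathcomp Require Import all_boot.
From Stdlib Require Import Relation_Operators.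

Set Implicit Arguments.
Unset Strict Implicit.
Unset Printing Implicit Defensive.

Definition language (T : finType) := seq T -> Prop.

(* A family of languages: for every finite alphabet, the languages over that
   alphabet that belong to the family. *)
Definition family := forall T : finType, language T -> Prop.

Definition subfamily (F1 F2 : family) : Prop :=
  forall (T : finType) (L : language T), F1 T L -> F2 T L.

Definition proper_subfamily (F1 F2 : family) : Prop :=
  subfamily F1 F2 /\
  exists (T : finType) (L : language T), F2 T L /\ ~ F1 T L.

(* Disjointness of variables and terminals is built into the sum type. *)
Definition is_var (X T : Type) (x : X + T) : bool :=
  if x is inl _ then true else false.

Definition num_vars (X T : Type) (s : seq (X + T)) : nat :=
  count (@is_var X T) s.

Definition terminal_word (X T : Type) (u : seq T) : seq (X + T) :=
  [seq inr a | a <- u].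

Record cf_grammar (T : finType) := CFGrammar {
  cf_var : finType;
  cf_prods : seq (cf_var * seq (cf_var + T));
  cf_start : cf_var
}.

Section ContextFree.
Variables (T : finType) (G : cf_grammar T).

Inductive cf_step : seq (cf_var G + T) -> seq (cf_var G + T) -> Prop :=
| CFStep x y A nu of (A, nu) \in cf_prods G :
    cf_step (x ++ inl A :: y) (x ++ nu ++ y).

Definition cf_generates (u : seq T) : Prop :=
  clos_refl_trans _ cf_step [:: inl (cf_start G)] (terminal_word _ u).

End ContextFree.

Definition CFL : family := fun T L =>
  exists G : cf_grammar T, forall u, L u <-> cf_generates G u.

Inductive production (V I T : Type) :=
| Rewrite of V & seq (V + T)      (* A -> nu *)
| Push of V & V & I               (* A -> B f *)
| Pop of V & I & seq (V + T).     (* A f -> nu *)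

Arguments Rewrite {V I T}.
Arguments Push {V I T}.
Arguments Pop {V I T}.

Section ProductionEqType.
Variables V I T : finType.

Definition production_code (p : production V I T) :
    (V * seq (V + T)) + ((V * V * I) + (V * I * seq (V + T))) :=
  match p with
  | Rewrite A nu => inl (A, nu)
  | Push A B f => inr (inl (A, B, f))
  | Pop A f nu => inr (inr (A, f, nu))
  end.

Definition production_decode
    (c : (V * seq (V + T)) + ((V * V * I) + (V * I * seq (V + T)))) :
    production V I T :=
  match c with
  | inl (A, nu) => Rewrite A nu
  | inr (inl (A, B, f)) => Push A B f
  | inr (inr (A, f, nu)) => Pop A f nu
  end.

Lemma production_codeK : cancel production_code production_decode.
Proof. by case. Qed.

HB.instance Definition _ :=
  Countable.copy (production V I T) (can_type production_codeK).

End ProductionEqType.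

Record indexed_grammar (T : finType) := IndexedGrammar {
  ind_var : finType;
  ind_index : finType;
  ind_prods : seq (production ind_var ind_index T);
  ind_start : ind_var
}.

Definition rhs_vars (V I T : Type) (p : production V I T) : nat :=
  match p with
  | Rewrite _ nu => num_vars nu
  | Push _ _ _ => 1
  | Pop _ _ nu => num_vars nu
  end.

Definition special (V I T : Type) (p : production V I T) : bool :=
  2 <= rhs_vars p.

(* A word of (V I^* + T)^*: [inl (A, alpha)] is the variable A together with
   the maximal word alpha of indices that follows it. *)
Definition sentential (V I T : Type) := seq ((V * seq I) + T).

Definition attach (V I T : Type) (alpha : seq I) (nu : seq (V + T)) :
    sentential V I T :=
  [seq match x with inl B => inl (B, alpha) | inr a => inr a end | x <- nu].

Inductive applies (V I T : Type) :
    production V I T -> sentential V I T -> sentential V I T -> Prop :=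
| ApplyRewrite x y A alpha nu :
    applies (Rewrite A nu)
      (x ++ inl (A, alpha) :: y) (x ++ attach alpha nu ++ y)
| ApplyPush x y A B f alpha :
    applies (Push A B f)
      (x ++ inl (A, alpha) :: y) (x ++ inl (B, f :: alpha) :: y)
| ApplyPop x y A f alpha nu :
    applies (Pop A f nu)
      (x ++ inl (A, f :: alpha) :: y) (x ++ attach alpha nu ++ y).

Section Indexed.
Variables (T : finType) (G : indexed_grammar T).

Local Notation rule := (production (ind_var G) (ind_index G) T).
Local Notation sform := (sentential (ind_var G) (ind_index G) T).

Definition ind_axiom : sform := [:: inl (ind_start G, [::])].

(* A derivation starting from x, given by its successive steps: the production
   applied and the sentential form obtained. *)
Fixpoint derivation (x : sform) (d : seq (rule * sform)) : Prop :=
  if d is (p, y) :: d' then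
    [/\ p \in ind_prods G, applies p x y & derivation y d']
  else True.

Definition forms (d : seq (rule * sform)) : seq sform :=
  ind_axiom :: [seq s.2 | s <- d].

Definition derivation_of (u : seq T) (d : seq (rule * sform)) : Prop :=
  derivation ind_axiom d /\ last ind_axiom (forms d) = terminal_word _ u.

Definition ind_generates (u : seq T) : Prop := exists d, derivation_of u d.

Definition successful (d : seq (rule * sform)) : Prop :=
  exists u, derivation_of u d.

Definition index_at_most (k : nat) (d : seq (rule * sform)) : bool :=
  all (fun x => num_vars x <= k) (forms d).

Definition linear_indexed : Prop :=
  forall p, p \in ind_prods G -> rhs_vars p <= 1.

Definition one_special : Prop :=
  forall d, successful d -> count (fun s => special s.1) d <= 1.

Definition uncontrolled_finite_index : Prop :=
  exists2 k, 1 <= k & forall d, successful d -> index_at_most k d.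

Definition finite_index : Prop :=
  exists2 k, 1 <= k &
    forall u, ind_generates u -> exists2 d, derivation_of u d & index_at_most k d.

End Indexed.

Definition generated_by
    (C : forall T : finType, indexed_grammar T -> Prop) : family :=
  fun T L => exists2 G : indexed_grammar T,
    C T G & forall u, L u <-> ind_generates G u.

Definition IND_LIN : family := generated_by linear_indexed.
Definition IND_UFIN1 : family := generated_by one_special.
Definition IND_UFIN : family := generated_by uncontrolled_finite_index.
Definition IND_FIN : family := generated_by finite_index.

(* Main.v *)
From HB Require Import structures.
From mathcomp Require Import all_boot zify.
From Stdlib Require Import Relation_Operators Operators_Properties.
Require Import Defs.

Set Implicit Arguments.
Unset Strict Implicit.
Unset Printing Implicit Defensive.

(* All three separations come from one interchange argument. Cut a derivation
   at the moments where a pushed index is popped: it becomes a tree of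
   judgements "A derives s whatever the stack below A", which behaves like a
   context-free derivation tree whose nonterminals are A together with the
   variables of s. If at most k variables ever carry a common pushed index,
   there are finitely many nonterminals, so a long word has two subderivations
   of the same kind, with different but bounded numbers of letters, and the
   smaller one can be replaced by the larger one.
   - Context-free grammars are the case k = 0, linear indexed grammars are
     covered by k = 1, uncontrolled finite-index grammars by their index.
   - The words a_1^n ... a_j^n with j = 2k + 3 are not generated with parameter
     k: a bounded subderivation lies in k + 1 infixes, each meeting at most two
     blocks, so it misses a letter, and the exchange changes the length of the
     word but not the number of occurrences of that letter.
   - The unary language of triangular lengths has unbounded gaps, so it is not
     generated for any k, but it has index 2 when the summands are emitted one
     after the other. *)

(** * Words mixing variables and letters *)

Definition vars (X T : Type) (s : seq (X + T)) : seq X :=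
  pmap (fun x => if x is inl A then Some A else None) s.
Definition letters (X T : Type) (s : seq (X + T)) : seq T :=
  pmap (fun x => if x is inr a then Some a else None) s.

Section Words.
Variables X T : finType.
Implicit Types (u v : seq T) (s t : seq (X + T)) (ss : seq (seq (X + T))).

Lemma num_vars_cat (Y U : Type) (s t : seq (Y + U)) :
  num_vars (s ++ t) = num_vars s + num_vars t.
Proof. exact: count_cat. Qed.

Lemma num_vars_terminal (Y U : Type) (u : seq U) :
  num_vars (terminal_word Y u) = 0.
Proof. by elim: u. Qed.

Lemma terminal_word_cat (Y U : Type) (u v : seq U) :
  terminal_word Y (u ++ v) = terminal_word Y u ++ terminal_word Y v.
Proof. exact: map_cat. Qed.

Lemma vars_cat s t : vars (s ++ t) = vars s ++ vars t.
Proof. exact: pmap_cat. Qed.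

Lemma size_vars s : size (vars s) = num_vars s.
Proof. by elim: s => [|[A|a] s IH] //=; rewrite IH. Qed.

Lemma letters_cat s t : letters (s ++ t) = letters s ++ letters t.
Proof. exact: pmap_cat. Qed.

Lemma letters_terminal u : letters (terminal_word X u) = u.
Proof. by elim: u => //= a u ->. Qed.

Lemma terminal_letters s : num_vars s = 0 -> s = terminal_word X (letters s).
Proof. by elim: s => [|[A|a] s IH] //= /IH {1}->. Qed.

Lemma num_vars_attach (I : Type) (alpha : seq I) s :
  num_vars (attach alpha s) = num_vars s.
Proof. by elim: s => [|[A|a] s IH] //=; rewrite IH. Qed.

Lemma attach_cat (I : Type) (alpha : seq I) s t :
  attach alpha (s ++ t) = attach alpha s ++ attach alpha t.
Proof. exact: map_cat. Qed.

Lemma attach_terminal (I : Type) (alpha : seq I) u :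
  attach alpha (terminal_word X u) = terminal_word _ u.
Proof. by elim: u => //= a u ->. Qed.

(** Models the popping of an index carried by [t]: its letters stay in place and each variable, in
    order, gives way to what its pop derives. *)
Fixpoint fill t ss : seq (X + T) :=
  match t, ss with
  | inr a :: t', _ => inr a :: fill t' ss
  | inl _ :: t', s :: ss' => s ++ fill t' ss'
  | _, _ => [::]
  end.

Lemma count_fill P t ss : size ss = num_vars t ->
  count P (letters (fill t ss)) =
  count P (letters t) + \sum_(s <- ss) count P (letters s).
Proof.
elim: t ss => [|[A|a] t IH] [|s ss] //=.
- by rewrite big_nil.
- by case=> /IH E; rewrite letters_cat count_cat E big_cons; lia.
- by move=> E; rewrite IH //; lia.
- by move=> E; rewrite IH //; lia.
Qed.

Lemma vars_fill t ss : size ss = num_vars t ->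
  vars (fill t ss) = flatten [seq vars s | s <- ss].
Proof.
elim: t ss => [|[A|a] t IH] [|s ss] //=.
- by case=> /IH E; rewrite vars_cat E.
- by move/(IH [::]).
- by move/(IH (s :: ss)).
Qed.

Lemma prefix_fill v t ss : size ss = num_vars t ->
  prefix (terminal_word X v) t -> prefix (terminal_word X v) (fill t ss).
Proof.
elim: v t ss => [|a v IH] [|[A|b] t] ss //= E.
  by rewrite prefix0s.
by case/andP=> -> /(IH _ _ E).
Qed.

(** A variable-free infix of [t] contains none of the places where words are inserted, so filling
    leaves it intact. *)
Lemma infix_fill v t ss : size ss = num_vars t ->
  infix (terminal_word X v) t -> infix (terminal_word X v) (fill t ss).
Proof.
elim: t ss => [|x t IH] ss E.
  by rewrite infixs0 => /eqP->; case: ss {E}.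
rewrite infix_consl => /orP[/(prefix_fill E)/prefixW //|].
case: x ss E => [A|a] ss E inf; last first.
  by rewrite [fill _ _]/= infix_consl IH ?orbT.
case: ss E => [|s ss] //= [E].
exact/infix_catl/IH.
Qed.

End Words.

(** * Derivations and denotations of sentential forms *)

Section Derivations.
Variables (T : finType) (G : indexed_grammar T).
Local Notation V := (ind_var G).
Local Notation I := (ind_index G).
Local Notation rule := (production V I T).
Local Notation sform := (sentential V I T).
Local Notation form := (seq (V + T)).
Implicit Types (p : rule) (x y z : sform) (s t nu : form) (alpha : seq I).

Inductive expands : rule -> V -> seq I -> sform -> Prop :=
| ExpandRewrite A nu alpha : expands (Rewrite A nu) A alpha (attach alpha nu)
| ExpandPush A B f alpha :
    expands (Push A B f) A alpha [:: inl (B, f :: alpha)]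
| ExpandPop A f nu alpha :
    expands (Pop A f nu) A (f :: alpha) (attach alpha nu).

Lemma expandsE p A alpha z : expands p A alpha z ->
  match p with
  | Rewrite B nu => B = A /\ z = attach alpha nu
  | Push B C f => B = A /\ z = [:: inl (C, f :: alpha)]
  | Pop B f nu =>
      B = A /\ exists2 beta, alpha = f :: beta & z = attach beta nu
  end.
Proof. by case=> // B f nu beta; split=> //; exists beta. Qed.

Lemma appliesP p x y : applies p x y <->
  exists l r A alpha z,
    [/\ x = l ++ inl (A, alpha) :: r, y = l ++ z ++ r & expands p A alpha z].
Proof.
split.
  case=> {p x y} [l r A al nu|l r A B f al|l r A f al nu]; do 5!eexists;
  by split; [| |constructor].
by case=> l [r] [A] [al] [z] [-> ->]; case; constructor.
Qed.

Lemma applies_cat p l x y r : applies p x y -> applies p (l ++ x ++ r) (l ++ y ++ r).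
Proof.
case/appliesP=> l' [r'] [A] [al] [z] [-> -> e]; apply/appliesP.
exists (l ++ l'), (r' ++ r), A, al, z.
by split; rewrite // -?catA.
Qed.

(** [Q] is required of every form passed through, so one relation serves both for unrestricted
    derivations and for derivations of bounded index. *)
Inductive derives (Q : pred sform) : sform -> sform -> Prop :=
| DerivesRefl x of Q x : derives Q x x
| DerivesStep p x y z of p \in ind_prods G & Q x & applies p x y &
    derives Q y z : derives Q x z.

Lemma derives_trans Q y x z : derives Q x y -> derives Q y z -> derives Q x z.
Proof.
move=> d; elim: d z => {x y} // p x y z pG Qx a _ IH w dw.
exact: DerivesStep pG Qx a (IH _ dw).
Qed.

Lemma derives_cat (Q Q' : pred sform) l x y r :
    (forall z, Q z -> Q' (l ++ z ++ r)) ->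
  derives Q x y -> derives Q' (l ++ x ++ r) (l ++ y ++ r).
Proof.
move=> QQ'; elim=> {x y} [x Qx|p x y z pG Qx a _ IH].
  by apply: DerivesRefl; apply: QQ'.
by apply: DerivesStep (QQ' _ Qx) (applies_cat l r a) IH.
Qed.

Lemma derives_expand (Q : pred sform) p A alpha z y :
    p \in ind_prods G -> Q [:: inl (A, alpha)] -> expands p A alpha z ->
  derives Q z y -> derives Q [:: inl (A, alpha)] y.
Proof.
move=> pG Qx e d; apply: DerivesStep pG Qx _ d.
by apply/appliesP; exists [::], [::], A, alpha, z; rewrite /= cats0.
Qed.

Lemma derivesP (Q : pred sform) x y : derives Q x y <->
  exists d, [/\ derivation x d, last x [seq e.2 | e <- d] = y
              & all Q (x :: [seq e.2 | e <- d])].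
Proof.
split.
  elim=> {x y} [x Qx|p x y z pG Qx a _ [d [dy <- ay]]].
    by exists [::]; split=> //=; rewrite Qx.
  by exists ((p, y) :: d); split=> //=; rewrite Qx.
case=> d; elim: d x => [|[p z] d IH] x [/= dx lx /andP[Qx aQ]].
  by rewrite -lx; apply: DerivesRefl.
case: dx => pG a dz; apply: DerivesStep pG Qx a _.
by apply: IH; split.
Qed.

Definition star := derives xpredT.

Lemma star_refl x : star x x.
Proof. exact: DerivesRefl. Qed.

Lemma star_trans y x z : star x y -> star y z -> star x z.
Proof. exact: derives_trans. Qed.

Lemma star_expand p A alpha z y :
    p \in ind_prods G -> expands p A alpha z ->
  star z y -> star [:: inl (A, alpha)] y.
Proof. by move=> pG; apply: derives_expand. Qed.

Lemma star_rewrite A nu alpha y : Rewrite A nu \in ind_prods G ->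
  star (attach alpha nu) y -> star [:: inl (A, alpha)] y.
Proof. by move=> AP; apply: (star_expand AP); constructor. Qed.

Lemma star_push A B f alpha y : Push A B f \in ind_prods G ->
  star [:: inl (B, f :: alpha)] y -> star [:: inl (A, alpha)] y.
Proof. by move=> AP; apply: (star_expand AP); constructor. Qed.

Lemma star_pop A f nu alpha y : Pop A f nu \in ind_prods G ->
  star (attach alpha nu) y -> star [:: inl (A, f :: alpha)] y.
Proof. by move=> AP; apply: (star_expand AP); constructor. Qed.

Lemma star_ctx l x y r : star x y -> star (l ++ x ++ r) (l ++ y ++ r).
Proof. exact: derives_cat. Qed.

Lemma star_cat x1 y1 x2 y2 : star x1 y1 -> star x2 y2 -> star (x1 ++ x2) (y1 ++ y2).
Proof.
move=> d1 d2; apply: (@star_trans (y1 ++ x2)).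
  exact: (star_ctx [::] x2 d1).
by have := star_ctx y1 [::] d2; rewrite !cats0.
Qed.

Lemma star_cons a x y : star x y -> star (inr a :: x) (inr a :: y).
Proof. exact: (star_cat (star_refl [:: inr a])). Qed.

Lemma ind_generatesP u :
  ind_generates G u <-> star (ind_axiom G) (terminal_word _ u).
Proof.
split=> [[d [dd lst]]|/derivesP[d [dd lst _]]].
  by apply/derivesP; exists d; rewrite all_predT.
by exists d.
Qed.

(** A reachable form that derives a word lies on a successful derivation, the concatenation of the
    two. *)
Lemma index_bounded k :
    (forall d : seq (rule * sform), successful d -> index_at_most k d) ->
  forall x u, star (ind_axiom G) x -> star x (terminal_word _ u) -> num_vars x <= k.
Proof.
move=> bnd x u /derivesP[d1 [dd1 l1 _]] /derivesP[d2 [dd2 l2 _]].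
have cat_d y : derivation y d1 -> last y [seq e.2 | e <- d1] = x ->
    derivation y (d1 ++ d2).
  elim: d1 y {dd1 l1} => [|[p z] d1 IH] y /=; first by move=> _ ->.
  by case=> pG a dz lz; split; last exact: IH.
have : index_at_most k (d1 ++ d2).
  apply: bnd; exists u; split; first exact: cat_d.
  by rewrite /forms /= map_cat last_cat l1.
rewrite /index_at_most /forms => /allP; apply.
rewrite map_cat -cat_cons mem_cat; apply/orP; left.
by rewrite -{1}l1 mem_last.
Qed.

(* The language denoted by a sentential form when D gives the language denoted
   by each variable with its stack. *)
Fixpoint sem (D : V -> seq I -> seq T -> Prop) (x : sform) (u : seq T) : Prop :=
  match x with
  | [::] => u = [::]
  | inr a :: x' => exists2 v, u = a :: v & sem D x' v
  | inl (A, alpha) :: x' =>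
      exists v w, [/\ u = v ++ w, D A alpha v & sem D x' w]
  end.

Lemma sem_cat D x y u :
  sem D (x ++ y) u <-> exists v w, [/\ u = v ++ w, sem D x v & sem D y w].
Proof.
elim: x u => [|[[A al]|a] x IH] u /=.
- by split=> [h|[v] [w] [-> -> ?]] //; exists [::], u.
- split=> [[v] [w] [-> DA /IH[w1 [w2 [-> s1 s2]]]]|[v] [w] [-> [v1 [v2 [-> DA s1]]] s2]].
    exists (v ++ w1), w2; split=> //; first by rewrite catA.
    by exists v, w1.
  exists v1, (v2 ++ w); split=> //; first by rewrite catA.
  by apply/IH; exists v2, w.
- split=> [[v -> /IH[v1 [v2 [-> s1 s2]]]]|[v] [w] [-> [v' -> s1] s2]].
    by exists (a :: v1), v2; split=> //; exists v1.
  by exists (v' ++ w) => //; apply/IH; exists v', w.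
Qed.

Lemma sem1 D A alpha u : sem D [:: inl (A, alpha)] u <-> D A alpha u.
Proof.
split=> [[v [w [-> DA ->]]]|DA]; first by rewrite cats0.
by exists u, [::]; rewrite cats0.
Qed.

Lemma sem_terminal D u : sem D (terminal_word _ u) u.
Proof. by elim: u => //= a u IH; exists u. Qed.

(** Induction backwards from the last step. The closure hypothesis may also use that the current
    form is reachable and that its context has a denotation; this later gives access to the index
    bound. *)
Lemma sem_star D :
    (forall p l A alpha r z v w v',
       p \in ind_prods G -> expands p A alpha z ->
       star (ind_axiom G) (l ++ inl (A, alpha) :: r) ->
       sem D l v -> sem D z w -> sem D r v' -> D A alpha w) ->
  forall x u, star (ind_axiom G) x -> star x (terminal_word _ u) -> sem D x u.
Proof.
move=> closed x u; move tu: (terminal_word _ u) => y rx d.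
elim: d tu rx => {x y} [x _ <- _|p x y z pG _ a d IH zu rx].
  exact: sem_terminal.
have ry : star (ind_axiom G) y.
  by apply: star_trans rx _; apply: DerivesStep pG _ a (star_refl _).
have /appliesP[l [r [A [al [w [ex ey e]]]]]] := a.
move: (IH zu ry); rewrite ey => /sem_cat[v1 [v2 [-> s1]]].
case/sem_cat=> v3 [v4 [-> s3 s4]].
rewrite ex; apply/sem_cat; exists v1, (v3 ++ v4); split=> //.
exists v3, v4; split=> //.
by apply: (closed p l A al r w v1 v3 v4) => //; rewrite -ex.
Qed.

Lemma star_sem D x u :
    (forall A alpha v, D A alpha v -> star [:: inl (A, alpha)] (terminal_word _ v)) ->
  sem D x u -> star x (terminal_word _ u).
Proof.
move=> snd; elim: x u => [|[[A al]|a] x IH] u /=.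
- by move->; apply: star_refl.
- case=> v [w] [-> /snd dv /IH dw].
  by rewrite terminal_word_cat; apply: (star_cat dv dw).
- by case=> v -> /IH; apply: star_cons.
Qed.

End Derivations.

(** * Stack-independent derivations *)

Section Yields.
Variables (T : finType) (G : indexed_grammar T) (k : nat).
Local Notation V := (ind_var G).
Local Notation I := (ind_index G).
Local Notation form := (seq (V + T)).
Implicit Types (s t nu mu : form) (u v : seq T) (f : I) (alpha beta : seq I).

Inductive pops f : form -> form -> Prop :=
| PopsNil : pops f [::] [::]
| PopsTerminal a t t' of pops f t t' : pops f (inr a :: t) (inr a :: t')
| PopsVar A mu t t' of Pop A f mu \in ind_prods G & pops f t t' :
    pops f (inl A :: t) (mu ++ t').

(* [yields nu s]: the form nu derives s without looking at the stack it is
   attached to. Every index pushed in between is popped again, and at most k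
   variables carry it when that happens. *)
Inductive yields : form -> form -> Prop :=
| YieldsNil : yields [::] [::]
| YieldsTerminal a nu s of yields nu s : yields (inr a :: nu) (inr a :: s)
| YieldsKeep A nu s of yields nu s : yields (inl A :: nu) (inl A :: s)
| YieldsRewrite A mu nu s1 s2 of Rewrite A mu \in ind_prods G &
    yields mu s1 & yields nu s2 : yields (inl A :: nu) (s1 ++ s2)
| YieldsPush A B f t t' nu s1 s2 of Push A B f \in ind_prods G &
    yields [:: inl B] t & num_vars t <= k & pops f t t' &
    yields t' s1 & yields nu s2 : yields (inl A :: nu) (s1 ++ s2).

Lemma pops_cat f t1 t1' t2 t2' :
  pops f t1 t1' -> pops f t2 t2' -> pops f (t1 ++ t2) (t1' ++ t2').
Proof.
move=> p1 p2; elim: p1 => {t1 t1'} [|a t t' _ IH|A mu t t' AP _ IH] //=.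
  exact: PopsTerminal.
by rewrite -catA; apply: PopsVar.
Qed.

Lemma yields_cat nu1 nu2 s1 s2 :
  yields nu1 s1 -> yields nu2 s2 -> yields (nu1 ++ nu2) (s1 ++ s2).
Proof.
move=> y1 y2; elim: y1 => {nu1 s1} //=.
- by move=> a nu s _ IH; apply: YieldsTerminal.
- by move=> A nu s _ IH; apply: YieldsKeep.
- move=> A mu nu s s' AP ymu _ _ IH; rewrite -catA.
  exact: YieldsRewrite AP ymu IH.
- move=> A B f t t' nu s s' AP yB _ tk tp yt _ _ IH; rewrite -catA.
  exact: YieldsPush AP yB tk tp yt IH.
Qed.

Lemma yields_refl nu : yields nu nu.
Proof. by elim: nu => [|[A|a] nu IH]; constructor. Qed.

Lemma yields_split nu1 nu2 s : yields (nu1 ++ nu2) s ->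
  exists s1 s2, [/\ s = s1 ++ s2, yields nu1 s1 & yields nu2 s2].
Proof.
move en: (nu1 ++ nu2) => nu y.
elim: y nu1 en => {nu s} [|a nu s y IH|A nu s y IH|
    A mu nu s s' AP ymu _ y IH|A B f t t' nu s s' AP yB _ tk tp yt _ y IH] [|x nu1] //=.
- by move=> en; exists [::], [::]; rewrite en; split=> //; apply: YieldsNil.
- by move=> ->; exists [::], (inr a :: s); split=> //; constructor.
- case=> -> /IH[s1 [s2 [-> y1 y2]]].
  by exists (inr a :: s1), s2; split=> //; constructor.
- by move=> ->; exists [::], (inl A :: s); split=> //; constructor.
- case=> -> /IH[s1 [s2 [-> y1 y2]]].
  by exists (inl A :: s1), s2; split=> //; constructor.
- move=> ->; exists [::], (s ++ s').
  by split; [|exact: YieldsNil|exact: YieldsRewrite AP ymu y].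
- case=> -> /IH[s1 [s2 [-> y1 y2]]].
  by exists (s ++ s1), s2; rewrite catA; split=> //; apply: YieldsRewrite AP ymu y1.
- move=> ->; exists [::], (s ++ s').
  by split; [|exact: YieldsNil|exact: YieldsPush AP yB tk tp yt y].
- case=> -> /IH[s1 [s2 [-> y1 y2]]].
  by exists (s ++ s1), s2; rewrite catA; split=> //; apply: YieldsPush AP yB tk tp yt y1.
Qed.

Lemma pops_star f t t' alpha :
  pops f t t' -> star (attach (f :: alpha) t) (attach alpha t').
Proof.
elim=> {t t'} [|a t t' _ IH|A mu t t' AP _ IH].
- exact: star_refl.
- exact: star_cons.
- rewrite attach_cat; apply: (star_cat (x1 := [:: _]) _ IH).
  exact: star_pop AP (star_refl _).
Qed.

Lemma yields_star nu s alpha :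
  yields nu s -> star (attach alpha nu) (attach alpha s).
Proof.
move=> y; elim: y alpha => {nu s} [al|a nu s _ IH al|A nu s _ IH al|
    A mu nu s s' AP _ IHmu _ IH al|A B f t t' nu s s' AP _ IHB tk tp _ IHt _ IH al].
- exact: star_refl.
- exact/star_cons/IH.
- exact: (star_cat (star_refl [:: _]) (IH al)).
- rewrite attach_cat; apply: (star_cat (x1 := [:: _]) _ (IH al)).
  exact: star_rewrite AP (IHmu al).
- rewrite attach_cat; apply: (star_cat (x1 := [:: _]) _ (IH al)).
  apply: star_push AP _.
  apply: star_trans (IHB (f :: al)) _.
  exact: star_trans (pops_star al tp) (IHt al).
Qed.

(** The stack is emptied one index at a time, [t] being the form whose variables all pop the top
    index. No bound on their number is imposed here; it enters only when the matching push is
    met. *)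
Fixpoint consumes alpha nu s : Prop :=
  if alpha is f :: alpha' then
    exists t t', [/\ yields nu t, pops f t t' & consumes alpha' t' s]
  else yields nu s.

Lemma consumes_star alpha nu s : consumes alpha nu s -> star (attach alpha nu) (attach [::] s).
Proof.
elim: alpha nu => [|f al IH] nu /=; first exact: yields_star.
case=> t [t' [y p /IH]]; apply: star_trans.
exact: star_trans (yields_star _ y) (pops_star al p).
Qed.

Lemma consumes_cat alpha nu1 nu2 s1 s2 :
  consumes alpha nu1 s1 -> consumes alpha nu2 s2 ->
  consumes alpha (nu1 ++ nu2) (s1 ++ s2).
Proof.
elim: alpha nu1 nu2 => [|f al IH] nu1 nu2 /=; first exact: yields_cat.
case=> t1 [t1' [y1 p1 c1]] [t2 [t2' [y2 p2 c2]]].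
exists (t1 ++ t2), (t1' ++ t2').
by split; [apply: yields_cat|apply: pops_cat|apply: IH].
Qed.

Lemma consumes_nil alpha : consumes alpha [::] [::].
Proof.
elim: alpha => [|f al IH]; first exact: YieldsNil.
by exists [::], [::]; split=> //; constructor.
Qed.

Lemma consumes_terminal alpha a : consumes alpha [:: inr a] [:: inr a].
Proof.
elim: alpha => [|f al IH] /=; first exact: yields_refl.
exists [:: inr a], [:: inr a]; split=> //; first exact: yields_refl.
by do 2!constructor.
Qed.

Lemma consumes_sub alpha nu nu' s :
  (forall t, yields nu t -> yields nu' t) -> consumes alpha nu s -> consumes alpha nu' s.
Proof.
move=> sub; case: alpha => [|f al] /=; first exact: sub.
by case=> t [t' [/sub y p c]]; exists t, t'.
Qed.

Definition denotes A alpha u := consumes alpha [:: inl A] (terminal_word V u).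

Lemma sem_attach alpha nu u :
  sem denotes (attach alpha nu) u -> consumes alpha nu (terminal_word V u).
Proof.
elim: nu u => [|[A|a] nu IH] u /=.
- by move->; apply: consumes_nil.
- case=> v [w [-> dA /IH c]]; rewrite terminal_word_cat.
  exact: (consumes_cat (nu1 := [:: _]) dA c).
- case=> v -> /IH c.
  exact: (consumes_cat (nu1 := [:: _]) (s1 := [:: _]) (consumes_terminal _ a) c).
Qed.

Lemma denotes_star A alpha u :
  denotes A alpha u -> star [:: inl (A, alpha)] (terminal_word _ u).
Proof. by move/consumes_star; rewrite attach_terminal. Qed.

Lemma generates_yields u : yields [:: inl (ind_start G)] (terminal_word V u) ->
  ind_generates G u.
Proof.
by move/(yields_star [::]); rewrite attach_terminal => /ind_generatesP.
Qed.

(** Follows from [sem_star], since [denotes] is closed under undoing a step. The index bound is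
    asked for only in the presence of a push production, so a grammar without pushes qualifies with
    [k = 0]. *)
Lemma yields_generates u :
    (forall A B f, Push A B f \in ind_prods G ->
       forall d : seq (production V I T * sentential V I T),
         successful d -> index_at_most k d) ->
  ind_generates G u -> yields [:: inl (ind_start G)] (terminal_word V u).
Proof.
move=> bnd /ind_generatesP gu.
suff /sem1: sem denotes (ind_axiom G) u by [].
apply: sem_star (star_refl _) gu => p l A al r z v w v' pG e.
case: p A al z / e pG => [A nu al|A B f al|A f nu al] pG reach sl sz sr.
- apply: consumes_sub (sem_attach sz) => t y.
  by rewrite -[t]cats0; apply: YieldsRewrite pG y YieldsNil.
- have [t [t' [yB tp c]]] := (sem1 _ _ _ _).1 sz.
  have dt : star (attach (f :: al) t) (terminal_word _ w).
    apply: star_trans (pops_star al tp) _.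
    by rewrite -(attach_terminal _ [::] w); apply: consumes_star.
  apply: consumes_sub c => s y.
  (* The form just before the pops of [f], placed between [l] and [r], is reachable and derives
     [v ++ w ++ v']; hence it occurs in a successful derivation and has at most [k] variables. *)
  suff tk : num_vars t <= k.
    by rewrite -[s]cats0; apply: YieldsPush pG yB tk tp y YieldsNil.
  suff : num_vars (l ++ attach (f :: al) t ++ r) <= k.
    by rewrite !num_vars_cat num_vars_attach; lia.
  apply: (index_bounded (bnd _ _ _ pG) (u := v ++ w ++ v')).
    apply: star_trans reach _; apply: (star_ctx l r (x := [:: _])).
    apply: star_push pG _.
    exact: (yields_star (f :: al) yB).
  rewrite !terminal_word_cat; apply: star_cat; last apply: star_cat => //.
    exact: star_sem denotes_star sl.
  exact: star_sem denotes_star sr.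
- exists [:: inl A], (nu ++ [::]); split; first exact: yields_refl.
    by apply: PopsVar pG (PopsNil _).
  by rewrite cats0; apply: sem_attach.
Qed.

(** Records everything that happens from the pop of [f] onwards, and depends on the popped form only
    through its list of variables. Any form with the same variables can therefore take its place. *)
Fixpoint pop_yields f (vs : seq V) (ss : seq form) : Prop :=
  match vs, ss with
  | [::], [::] => True
  | A :: vs', s :: ss' =>
      (exists2 mu, Pop A f mu \in ind_prods G & yields mu s) /\ pop_yields f vs' ss'
  | _, _ => False
  end.

Lemma pop_yields_size f vs ss : pop_yields f vs ss -> size ss = size vs.
Proof. by elim: vs ss => [|A vs IH] [|s ss] //= [_ /IH->]. Qed.

Lemma pops_yields_fill f t t' s : pops f t t' -> yields t' s ->
  exists2 ss, pop_yields f (vars t) ss & s = fill t ss.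
Proof.
move=> p; elim: p s => {t t'} [|a t t' _ IH|A mu t t' AP _ IH] s y.
- by exists [::]; inversion y.
- inversion y; subst; case/IH: H2 => ss pss ->.
  by exists ss.
- case/yields_split: y => s1 [s2 [-> y1 /IH[ss pss ->]]].
  by exists (s1 :: ss) => //=; split=> //; exists mu.
Qed.

Lemma fill_pops_yields f t ss : pop_yields f (vars t) ss ->
  exists2 t', pops f t t' & yields t' (fill t ss).
Proof.
elim: t ss => [|[A|a] t IH] ss /=.
- by case: ss => // _; exists [::]; constructor.
- case: ss => // s ss [[mu AP y] /IH[t' p y']].
  by exists (mu ++ t'); [apply: PopsVar|apply: yields_cat].
- by case/IH=> t' p y; exists (inr a :: t'); constructor.
Qed.

End Yields.

(** * Interchange *)

Section Interchange.
Variables (T : finType) (G : indexed_grammar T) (k : nat).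
Local Notation V := (ind_var G).
Local Notation I := (ind_index G).
Local Notation form := (seq (V + T)).
Local Notation yields := (@yields T G k).
Implicit Types (s t nu mu : form) (u v : seq T) (f : I).

Definition rhs_size (p : production V I T) : nat :=
  match p with
  | Rewrite _ mu | Pop _ _ mu => size mu
  | Push _ _ _ => 1
  end.

Definition max_rhs := \max_(p <- ind_prods G) rhs_size p.

Lemma rhs_size_max p : p \in ind_prods G -> rhs_size p <= max_rhs.
Proof. by move=> pG; rewrite /max_rhs (leq_bigmax_seq _ pG). Qed.

Lemma num_vars_letters s : num_vars s + size (letters s) = size s.
Proof. by elim: s => [|[A|a] s IH] //=; rewrite -IH; lia. Qed.

Lemma infix_terminal v u :
  infix (terminal_word V v) (terminal_word V u) -> infix v u.
Proof.
case/infixP=> s [t /(congr1 (@letters V T))].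
by rewrite !letters_cat !letters_terminal => ->; apply: infix_infix.
Qed.

Lemma pops_size f t t' : pops f t t' ->
  size (letters t') <= size (letters t) + num_vars t * max_rhs /\
  num_vars t' <= num_vars t * max_rhs.
Proof.
elim=> {t t'} [|a t t' _ [IH1 IH2]|A mu t t' AP _ [IH1 IH2]] //=.
have := rhs_size_max AP; rewrite /= -num_vars_letters => b.
by rewrite letters_cat size_cat num_vars_cat; split; nia.
Qed.

(* Inside the derivation of s from nu there is a subderivation from a single
   variable with more than m and at most M letters, which may be exchanged for
   any other one with the same variables. *)
Definition interchangeable m M nu s := exists A s',
  [/\ yields [:: inl A] s',
      m < size (letters s') <= M,
      num_vars s' <= maxn k (num_vars s),
      forall v, infix (terminal_word V v) s' -> infix (terminal_word V v) s
    & forall s1, yields [:: inl A] s1 -> vars s1 = vars s' ->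
      exists s2, [/\ yields nu s2, vars s2 = vars s &
        forall P, count P (letters s2) + count P (letters s') =
                  count P (letters s) + count P (letters s1)]].

(** The subderivation found inside [s] also serves for [s']: an exchange inside [s] is carried over
    by the last hypothesis, and the two balance equations for letter counts add up. *)
Lemma interchangeable_ctx m M nu s nu' s' :
    interchangeable m M nu s ->
    num_vars s <= maxn k (num_vars s') ->
    (forall v, infix (terminal_word V v) s -> infix (terminal_word V v) s') ->
    (forall s2, yields nu s2 -> vars s2 = vars s ->
      exists s2', [/\ yields nu' s2', vars s2' = vars s' &
        forall P, count P (letters s2') + count P (letters s) =
                  count P (letters s') + count P (letters s2)]) ->
  interchangeable m M nu' s'.
Proof.
case=> A [t [yt mt vt it ex]] nv inf sub; exists A, t; split=> //.
- by move: vt nv; rewrite /maxn; do 2?case: ifP; lia.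
- by move=> v /it /inf.
move=> s1 y1 /(ex _ y1)[s2 [y2 v2 c2]].
have [s2' [y2' v2' c2']] := sub s2 y2 v2.
by exists s2'; split=> // P; have := c2 P; have := c2' P; lia.
Qed.

Lemma interchangeable_self m M A s :
  yields [:: inl A] s -> m < size (letters s) <= M -> interchangeable m M [:: inl A] s.
Proof.
move=> y mM; exists A, s; split=> //; first exact: leq_maxr.
by move=> s1 y1 v1; exists s1; split=> // P; rewrite addnC.
Qed.

Lemma interchangeable_catl m M nu1 nu2 s1 s2 : interchangeable m M nu1 s1 ->
  yields nu2 s2 -> interchangeable m M (nu1 ++ nu2) (s1 ++ s2).
Proof.
move=> int y2; apply: interchangeable_ctx int _ _ _.
- by rewrite num_vars_cat /maxn; case: ifP; lia.
- by move=> v i; apply: infix_catr.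
move=> s y vs; exists (s ++ s2); split; first exact: yields_cat.
  by rewrite !vars_cat vs.
by move=> P; rewrite !letters_cat !count_cat; lia.
Qed.

Lemma interchangeable_catr m M nu1 nu2 s1 s2 : yields nu1 s1 ->
  interchangeable m M nu2 s2 -> interchangeable m M (nu1 ++ nu2) (s1 ++ s2).
Proof.
move=> y1 int; apply: interchangeable_ctx int _ _ _.
- by rewrite num_vars_cat /maxn; case: ifP; lia.
- by move=> v i; apply: infix_catl.
move=> s y vs; exists (s1 ++ s); split; first exact: yields_cat.
  by rewrite !vars_cat vs.
by move=> P; rewrite !letters_cat !count_cat; lia.
Qed.

(** The exchange replaces [t] by a form with the same variables, so the same pops and continuations
    fill it, and the bound [k] at the pop is preserved. *)
Lemma interchangeable_push m M A B f t t' s :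
    Push A B f \in ind_prods G -> num_vars t <= k -> pops f t t' -> yields t' s ->
  interchangeable m M [:: inl B] t -> interchangeable m M [:: inl A] s.
Proof.
move=> AP tk p y int.
have [ss pss es] := pops_yields_fill p y.
have sz : size ss = num_vars t by rewrite (pop_yields_size pss) size_vars.
apply: interchangeable_ctx int _ _ _; first by rewrite leq_max tk.
  by move=> v; rewrite es; apply: infix_fill.
move=> t2 y2 v2; rewrite -v2 in pss.
have sz2 : size ss = num_vars t2 by rewrite (pop_yields_size pss) size_vars.
have [t2' p2 y2'] := fill_pops_yields pss.
exists (fill t2 ss); split.
- rewrite -[fill _ _]cats0; apply: YieldsPush AP y2 _ p2 y2' (YieldsNil _ _).
  by rewrite -sz2 sz.
- by rewrite es !vars_fill.
- by move=> P; rewrite es !count_fill //; lia.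
Qed.

(** If every variable accounts for at most [m] letters, a push accounts for [m] letters before the
    pops, [k * max_rhs] letters created by them, and [m] for each of the at most [k * max_rhs]
    variables they create. The factor [k.+1] also covers a rewriting when [k = 0]. *)
Definition next_bound m := m + k.+1 * (max_rhs + max_rhs * m).

(** An innermost single-variable subderivation with more than [m] letters is built from parts with
    at most [m] letters per variable, so it stays below [next_bound m]. If there is none, each
    variable of [nu] contributes at most [m] letters. *)
Lemma yields_interchange m nu s : yields nu s ->
  interchangeable m (next_bound m) nu s \/
  size (letters s) <= size (letters nu) + num_vars nu * m.
Proof.
have one A nu' s1 s2 : yields [:: inl A] s1 -> yields nu' s2 ->
    interchangeable m (next_bound m) [:: inl A] s1 \/
      size (letters s1) <= next_bound m ->
    interchangeable m (next_bound m) nu' s2 \/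
      size (letters s2) <= size (letters nu') + num_vars nu' * m ->
    interchangeable m (next_bound m) (inl A :: nu') (s1 ++ s2) \/
      size (letters (s1 ++ s2)) <=
        size (letters (inl A :: nu')) + num_vars (inl A :: nu') * m.
  move=> y1 y2 [i1 _|le1]; first by left; apply: (interchangeable_catl (nu1 := [:: _])).
  case=> [i2|le2]; first by left; apply: (interchangeable_catr (nu1 := [:: _])).
  (* [s1] is known to be below [next_bound m]; above [m], it is itself the subderivation sought. *)
  have [gt|le] := ltnP m (size (letters s1)).
    left; apply: (interchangeable_catl (nu1 := [:: _])) => //.
    by apply: interchangeable_self; rewrite ?gt.
  by right; rewrite letters_cat size_cat /=; nia.
elim=> {nu s} [|a nu s y IH|A nu s y IH|A mu nu s1 s2 AP y1 IH1 y2 IH2|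
    A B f t t' nu s1 s2 AP yB IHB tk p yt IHt y2 IH2].
- by right.
- case: IH => [i|le]; last by right; rewrite /= addSn ltnS.
  left; apply: (interchangeable_catr (nu1 := [:: _]) (s1 := [:: _])) => //.
  exact: yields_refl.
- case: IH => [i|le]; last by right; rewrite /=; nia.
  left; apply: (interchangeable_catr (nu1 := [:: _]) (s1 := [:: _])) => //.
  exact: yields_refl.
- have yA : yields [:: inl A] s1.
    by rewrite -[s1]cats0; apply: YieldsRewrite AP y1 (YieldsNil _ _).
  apply: one => //; case: IH1 => [i1|le1]; [left|right].
    apply: interchangeable_ctx i1 _ _ _ => //; first exact: leq_maxr.
    move=> s y vs; exists s; split=> //; last by move=> P; rewrite addnC.
    by rewrite -[s]cats0; apply: YieldsRewrite AP y (YieldsNil _ _).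
  have := rhs_size_max AP; rewrite /= -num_vars_letters /next_bound => b.
  by nia.
- have yA : yields [:: inl A] s1.
    by rewrite -[s1]cats0; apply: YieldsPush AP yB tk p yt (YieldsNil _ _).
  apply: one => //; case: IHB => [iB|leB].
    by left; apply: (interchangeable_push AP tk p yt).
  case: IHt => [it|leT]; [left|right].
    apply: interchangeable_ctx it _ _ _ => //; first exact: leq_maxr.
    move=> s y vs; exists s; split=> //; last by move=> P; rewrite addnC.
    by rewrite -[s]cats0; apply: YieldsPush AP yB tk p y (YieldsNil _ _).
  have [q1 q2] := pops_size p; move: leB; rewrite /= add0n mul1n => leB.
  apply: leq_trans leT _; rewrite /next_bound mulSn.
  have q3 : num_vars t * max_rhs <= k * max_rhs by rewrite leq_mul2r tk orbT.
  have q4 : num_vars t' * m <= k * max_rhs * m.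
    by rewrite leq_mul2r (leq_trans q2 q3) orbT.
  rewrite mulnDr mulnA; lia.
Qed.

(* Pumping by interchange: among the subderivations of u found at increasing
   scales, two share their variables and their colour. *)
Lemma pumping (C : finType) (colour : form -> C) :
  exists D, forall u,
    yields [:: inl (ind_start G)] (terminal_word V u) -> D < size u ->
  exists s1 s2 u',
    [/\ [/\ num_vars s1 <= k, size (letters s1) <= D &
            forall v, infix (terminal_word V v) s1 -> infix v u],
        [/\ num_vars s2 <= k, size (letters s2) <= D &
            forall v, infix (terminal_word V v) s2 -> infix v u],
        colour s1 = colour s2, size (letters s1) < size (letters s2) &
        ind_generates G u' /\ forall P,
          count P u' + count P (letters s1) = count P u + count P (letters s2)].
Proof.
(* Pigeonhole: [N] keys against [N.+1] size windows from [scale i] to [scale i.+1]. The windows are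
   disjoint, so two subderivations with equal keys still differ in size. *)
pose K := (V * k.-bseq V * C)%type; pose N := #|{: K}|.
pose scale i := iter i next_bound 0.
have scale_mono : {homo scale : i j / i <= j}.
  move=> i j /subnK <-; elim: (j - i) => // d; rewrite addSn => /leq_trans-> //.
  exact: leq_addr.
exists (scale N.+1) => u yu Du.
have step (i : 'I_N.+1) : exists q : V * form,
    [/\ yields [:: inl q.1] q.2,
        scale i < size (letters q.2) <= scale i.+1,
        num_vars q.2 <= k,
        forall v, infix (terminal_word V v) q.2 -> infix v u
      & forall s1, yields [:: inl q.1] s1 -> vars s1 = vars q.2 ->
        exists u', ind_generates G u' /\ forall P,
          count P u' + count P (letters q.2) = count P u + count P (letters s1)].
  case: (yields_interchange (scale i) yu); last first.
    rewrite letters_terminal mul1n add0n => le.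
    have : scale i <= scale N.+1 by apply: scale_mono; apply: ltnW.
    by move: Du le; lia.
  case=> A [s [y sc nv inf ex]]; exists (A, s); split=> //=.
  - by move: nv; rewrite num_vars_terminal maxn0.
  - by move=> v /inf; apply: infix_terminal.
  move=> s1 y1 /(ex _ y1)[s2 [y2 v2 c2]].
  have nv2 : num_vars s2 = 0.
    by rewrite -size_vars v2 size_vars num_vars_terminal.
  exists (letters s2); split.
    by apply: (@generates_yields _ _ k); rewrite -terminal_letters.
  by move=> P; rewrite c2 letters_terminal.
have [q qP] := fin_all_exists step.
pose key i : K := ((q i).1, insub_bseq k (vars (q i).2), colour (q i).2).
have /injectivePn[i [j ij]] : ~~ injectiveb key.
  by apply/negP => /injectiveP/leq_card; rewrite card_ord ltnn.
wlog lt_ij : i j ij / i < j.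
  move=> wl; case: (ltngtP i j) => [|lt e|/val_inj e]; first exact: wl.
    by apply: (wl j i) => //; rewrite eq_sym.
  by rewrite e eqxx in ij.
have [yi /andP[_ hi] ki ii exi] := qP i.
have [yj /andP[hj Dj] kj ij' _] := qP j.
case=> eA ev ec.
(* [insub_bseq] falls back to a default on lists longer than [k]; both lists are short enough, so
   equal keys mean equal lists. *)
have {}ev : vars (q j).2 = vars (q i).2.
  by move/(congr1 val): ev; rewrite !val_insubd !size_vars ki kj.
rewrite -eA in yj; have [u' [gu' cu']] := exi _ yj ev.
have le_ij : size (letters (q i).2) < size (letters (q j).2).
  by apply: leq_ltn_trans hi (leq_ltn_trans _ hj); apply: scale_mono.
have Dj' : size (letters (q j).2) <= scale N.+1.
  by apply: leq_trans Dj (scale_mono _ _ _); apply: ltn_ord.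
exists (q i).2, (q j).2, u'; split=> //; split=> //.
exact: leq_trans (ltnW le_ij) Dj'.
Qed.

End Interchange.

(** * Words a_1^n ... a_j^n *)

Section Blocks.
Variable j : nat.

Definition block_word n : seq 'I_j := flatten [seq nseq n i | i <- enum 'I_j].

Definition block_language : language 'I_j := fun u => exists n, u = block_word n.

Lemma count_block n a : count_mem a (block_word n) = n.
Proof.
rewrite /block_word; have := enum_uniq 'I_j; have := mem_enum 'I_j a.
elim: (enum 'I_j) => //= i s IH; rewrite inE count_cat count_nseq /= eq_sym.
case: eqVneq => [->|_] /= ins /andP[ni us]; last by rewrite IH.
rewrite mul1n (_ : count _ _ = 0) ?addn0 //.
apply/eqP; rewrite -leqn0 leqNgt -has_count; apply/hasP=> -[b].
case/flattenP=> _ /mapP[c cs ->] /nseqP[-> _] /eqP e.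
by rewrite -e cs in ni.
Qed.

Lemma size_block n : size (block_word n) = j * n.
Proof.
rewrite -[in RHS](size_enum_ord j) /block_word.
elim: (enum 'I_j) => //= i s IH; by rewrite size_cat size_nseq IH mulSn.
Qed.

Lemma pairwise_block n : pairwise leq (map val (block_word n)).
Proof.
have : pairwise ltn (map val (enum 'I_j)).
  by rewrite val_enum_ord -sorted_pairwise ?iota_ltn_sorted //; apply: ltn_trans.
rewrite /block_word; elim: (enum 'I_j) => //= i s IH /andP[lt_i /IH ps].
rewrite map_cat pairwise_cat ps andbT; apply/andP; split.
  apply/allrelP=> x y; rewrite map_nseq => /nseqP[-> _].
  case/mapP=> b /flattenP[_ /mapP[c cs ->] /nseqP[-> _]] ->.
  by apply/ltnW/(allP lt_i)/map_f.
by rewrite map_nseq; elim: (n) => //= m ->; rewrite andbT; apply/allP=> x /nseqP[-> _] /=.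
Qed.

(* An infix containing three different letters contains the whole block of the
   middle one. *)
Lemma infix_block v n :
  infix v (block_word n) -> size v < n -> size (undup v) <= 2.
Proof.
case/infixP=> p [q e] lt_v; have pw := pairwise_block n.
have cnt a := count_block n a; move: pw cnt; rewrite {}e => pw cnt.
rewrite leqNgt; apply/negP.
have : pairwise leq (map val (undup v)).
  move: pw; rewrite !map_cat !pairwise_cat => /and5P[_ _ _ pv _].
  by apply: subseq_pairwise pv; apply/map_subseq/undup_subseq.
have sub : {subset undup v <= v} by move=> a; rewrite mem_undup.
have := undup_uniq v; move: sub; case: (undup v) => [|a [|b [|c s]]] //= sub.
rewrite !inE !negb_or => /and4P[/and3P[ab _ _] /andP[bc _] _ _].
case/and4P=> /and3P[le_ab _ _] /andP[le_bc _] _ _ _.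
have va : a \in v by apply: sub; rewrite inE eqxx.
have vc : c \in v by apply: sub; rewrite !inE eqxx !orbT.
move: pw; rewrite !map_cat !pairwise_cat => /and5P[/allrelP pvq _ /allrelP vq _ _].
have np : b \notin p.
  apply: contra ab => bp; have := pvq (val b) (val a) (map_f _ bp).
  by rewrite mem_cat map_f // => /(_ isT) le; rewrite -val_eqE eqn_leq le_ab.
have nq : b \notin q.
  apply: contra bc => bq; have := vq (val c) (val b) (map_f _ vc) (map_f _ bq).
  by move=> le; rewrite -val_eqE eqn_leq le_bc.
have := cnt b; rewrite !count_cat (count_memPn np) (count_memPn nq) addn0 add0n => cb.
by have := count_size (pred1 b) v; rewrite cb leqNgt lt_v.
Qed.

End Blocks.

(** The variables cut [s] into [num_vars s + 1] variable-free stretches, each contributing at most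
    two distinct letters. *)
Lemma undup_letters (X T : finType) (s : seq (X + T)) :
    (forall v, infix (terminal_word X v) s -> size (undup v) <= 2) ->
  size (undup (letters s)) <= (num_vars s).+1.*2.
Proof.
(* [v] accumulates the part already read of the current stretch. *)
suff gen v : (forall w, infix (terminal_word X w) (terminal_word X v ++ s) ->
    size (undup w) <= 2) -> size (undup (v ++ letters s)) <= (num_vars s).+1.*2.
  exact: (gen [::]).
elim: s v => [|[A|a] s IH] v inf.
- by rewrite cats0; apply: inf; rewrite cats0 infix_refl.
- have -> : letters (inl A :: s) = letters s by [].
  rewrite undup_cat size_cat; apply: (@leq_trans (2 + (num_vars s).+1.*2)) => //.
  apply: leq_add.
    rewrite size_filter; apply: leq_trans (count_size _ _) _.
    by apply: inf; apply: prefix_infix.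
  apply: (IH [::]) => w i; apply: inf.
  by rewrite -cat_rcons; apply: infix_catl.
- have -> : v ++ letters (inr a :: s) = rcons v a ++ letters s by rewrite cat_rcons.
  apply: IH => w; rewrite /terminal_word map_rcons cat_rcons => i.
  exact: inf.
Qed.

Lemma blocks_not_generated k (G : indexed_grammar 'I_k.*2.+3) :
    (forall A B f, Push A B f \in ind_prods G ->
       forall d : seq (production (ind_var G) (ind_index G) _ * sentential _ _ _),
         successful d -> index_at_most k d) ->
  ~ (forall u, block_language u <-> ind_generates G u).
Proof.
move=> bnd LG.
(* The colour is a letter absent from [s], so equal colours provide one letter missing from both
   subderivations. *)
pose colour (s : seq (ind_var G + 'I_k.*2.+3)) := [pick a | a \notin letters s].
have [D pump] := @pumping _ G k _ colour.
pose u := block_word k.*2.+3 D.+1.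
have yu : yields k [:: inl (ind_start G)] (terminal_word (ind_var G) u).
  by apply: (yields_generates bnd); apply/LG; exists D.+1.
have Du : D < size u by rewrite size_block; nia.
have missing (s : seq (ind_var G + 'I_k.*2.+3)) : num_vars s <= k -> size (letters s) <= D ->
    (forall v, infix (terminal_word (ind_var G) v) s -> infix v u) ->
  exists a, a \notin letters s.
  move=> ks sD inf; apply/existsP; apply: contraT.
  rewrite negb_exists => /forallP all_in.
  have := @uniq_leq_size _ (enum 'I_k.*2.+3) (undup (letters s)) (enum_uniq _).
  have sub : {subset enum 'I_k.*2.+3 <= undup (letters s)}.
    by move=> a _; rewrite mem_undup; have := all_in a; rewrite negbK.
  move=> /(_ sub); rewrite size_enum_ord => le.
  have : size (undup (letters s)) <= (num_vars s).+1.*2.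
    apply: undup_letters => v iv; apply: (@infix_block _ _ D.+1) (inf v iv) _.
    rewrite ltnS; apply: leq_trans sD.
    case/infixP: iv => p [q ->]; rewrite !letters_cat letters_terminal !size_cat.
    by rewrite addnCA leq_addr.
  by move/(leq_trans le); rewrite doubleS !ltnS ltn_double ltnNge ks.
have [s1 [s2 [u' [[k1 D1 i1] [k2 D2 i2] c12 lt12 [gu' cnt]]]]] := pump u yu Du.
have [n eu'] := (LG u').2 gu'.
have [a [na1 na2]] : exists a, a \notin letters s1 /\ a \notin letters s2.
  move: c12; rewrite /colour; case: pickP => [a na|all_in]; last first.
    by case: (missing s1 k1 D1 i1) => a; rewrite all_in.
  case: pickP => [b nb [ab]|//]; exists a; split=> //.
  by rewrite ab.
(* The count of the missing letter forces [u'] to have the same exponent as [u]; the total count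
   then forces equal sizes, against [lt12]. *)
have := cnt (pred1 a).
rewrite (count_memPn na1) (count_memPn na2) !addn0 eu' !count_block => en.
have := cnt predT; rewrite !count_predT eu' en => /eqP; rewrite eqn_add2l => /eqP e12.
by rewrite e12 ltnn in lt12.
Qed.

(** * Context-free and linear grammars as cases of the block argument *)

Definition rewriting_grammar (T : finType) (G : cf_grammar T) : indexed_grammar T :=
  @IndexedGrammar T (cf_var G) void
    [seq Rewrite q.1 q.2 | q <- cf_prods G] (cf_start G).

Lemma rewriting_grammarP (T : finType) (G : cf_grammar T) u :
  cf_generates G u <-> ind_generates (rewriting_grammar G) u.
Proof.
pose erase (x : sentential (cf_var G) void T) : seq (cf_var G + T) :=
  [seq match e with inl A => inl A.1 | inr a => inr a end | e <- x].
have erase_attach al nu : erase (attach al nu) = nu.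
  by rewrite /erase /attach -map_comp map_id_in // => -[].
split.
  move=> gu; apply/ind_generatesP; rewrite -(attach_terminal _ [::] u).
  rewrite -[ind_axiom _]/(attach (T:=T) (I:=void) [::] [:: inl (cf_start G)]).
  elim: gu => [x y|x|x y z _ IH1 _ IH2].
  - case=> l r A nu AP; rewrite -cat1s !attach_cat; apply: star_ctx.
    have pG : Rewrite A nu \in ind_prods (rewriting_grammar G).
      by apply/mapP; exists (A, nu).
    exact: star_rewrite pG (star_refl _).
  - exact: star_refl.
  - exact: star_trans IH2.
move/ind_generatesP => gu.
rewrite /cf_generates; have -> : terminal_word (cf_var G) u = erase (terminal_word _ u).
  by rewrite -(attach_terminal _ [::] u) erase_attach.
suff cf x y : star (G := rewriting_grammar G) x y ->
  clos_refl_trans _ (cf_step (G:=G)) (erase x) (erase y) by apply: cf gu.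
elim=> {gu x y} [x _|p x y z pG _ a _ IH]; first exact: rt_refl.
apply: rt_trans IH; apply: rt_step.
case/mapP: pG a => -[A nu] AP -> /appliesP[l [r [B [al [w [-> ->]]]]]] e.
inversion e; subst; rewrite /erase !map_cat -!/(erase _) erase_attach.
by constructor.
Qed.

(** The translated grammar only rewrites, so the index hypothesis is vacuous and [k = 0] leaves
    three blocks out of reach. *)
Lemma CFL_blocks : ~ CFL (@block_language 3).
Proof.
case=> G LG; apply: (@blocks_not_generated 0 (rewriting_grammar G)).
  by move=> A B f /mapP[].
by move=> u; rewrite LG; apply: rewriting_grammarP.
Qed.

Lemma linear_index_at_most (T : finType) (G : indexed_grammar T) :
    linear_indexed G ->
  forall d : seq (production (ind_var G) (ind_index G) T * sentential _ _ _),
    successful d -> index_at_most 1 d.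
Proof.
move=> lin d [u [dd _]]; rewrite /index_at_most /forms.
move: dd; have : num_vars (ind_axiom G) <= 1 by [].
elim: d (ind_axiom G) => [|[p y] d IH] x nx; first by rewrite /= nx.
case=> pG /appliesP[l [r [A [al [z [ex ey e]]]]]] dy.
rewrite /= nx; apply: IH dy.
have nz : num_vars z <= 1.
  case: e (lin _ pG) {ex ey} => [B nu b|B C f b|B f nu b] //=;
  by rewrite num_vars_attach.
by move: nx; rewrite ex ey !num_vars_cat /=; lia.
Qed.

Lemma LIN_blocks : ~ IND_LIN (@block_language 5).
Proof.
case=> G lin LG; apply: (@blocks_not_generated 1 G) LG => A B f _ d.
exact: linear_index_at_most.
Qed.

(** * Grammars for three and five blocks *)

(** A push cannot emit a letter, so the first phase alternates: [LEmit] emits the first letter and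
    hands over to [LPush], or switches to [LPop]. *)
Inductive lin_var := LStart | LEmit | LPush | LPop.

Definition lin_var_code X : 'I_4 :=
  match X with LStart => inord 0 | LEmit => inord 1 | LPush => inord 2 | LPop => inord 3 end.
Definition lin_var_decode (i : 'I_4) :=
  match val i with 0 => LStart | 1 => LEmit | 2 => LPush | _ => LPop end.
Lemma lin_var_codeK : cancel lin_var_code lin_var_decode.
Proof. by case; rewrite /lin_var_decode /= inordK. Qed.

HB.instance Definition _ := Finite.copy lin_var (can_type lin_var_codeK).

Definition letter3 i : 'I_3 := inord i.

(* The index false marks the bottom of the stack. *)
Definition lin_prods : seq (production lin_var bool 'I_3) :=
  [:: Push LStart LEmit false;
      Rewrite LEmit [:: inr (letter3 0); inl LPush];
      Push LPush LEmit true;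
      Rewrite LEmit [:: inl LPop];
      Pop LPop true [:: inr (letter3 1); inl LPop; inr (letter3 2)];
      Pop LPop false [::]].

Definition lin_grammar : indexed_grammar 'I_3 :=
  @IndexedGrammar 'I_3 lin_var bool lin_prods LStart.

Definition lin_word l m : seq 'I_3 :=
  nseq l (letter3 0) ++ nseq m (letter3 1) ++ nseq m (letter3 2).

Lemma block_word3 n : block_word 3 n = lin_word n n.
Proof.
rewrite /block_word (_ : enum 'I_3 = [:: letter3 0; letter3 1; letter3 2]).
  by rewrite /= cats0.
by apply: (inj_map val_inj); rewrite val_enum_ord /= !inordK.
Qed.

Lemma nseq_rcons (A : Type) n (a : A) : nseq n a ++ [:: a] = nseq n.+1 a.
Proof. by rewrite -[[:: a]]/(nseq 1 a) -nseqD addn1. Qed.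

(** Each index above the marker stands for a pair of later letters still owed. [LPush] owes one pair
    more, for the letter just emitted and not yet recorded by a push. *)
Definition lin_denotes X (al : seq bool) (u : seq 'I_3) : Prop :=
  let m := index false al in
  match X with
  | LStart => exists n, u = lin_word n n
  | LEmit => exists n, u = lin_word n (n + m)
  | LPush => exists n, u = lin_word n (n + m).+1
  | LPop => u = lin_word 0 m
  end.

Lemma lin_grammar_sound u : ind_generates lin_grammar u -> block_language u.
Proof.
move/ind_generatesP=> gu.
suff /(sem1 (G := lin_grammar) lin_denotes)[n ->] :
    sem (G := lin_grammar) lin_denotes (ind_axiom lin_grammar) u.
  by exists n; rewrite block_word3.
apply: sem_star (star_refl _) gu => p l A al r z v w v' pG e _ _ sz _.
move: pG e sz; rewrite !inE => /or4P[|||/or3P[]] /eqP-> /expandsE[<-] /=.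
- by move=> -> /= [v1 [v2 [-> [n ->] ->]]]; exists n; rewrite cats0 addn0.
- move=> -> /= [_ -> [v1 [v2 [-> [n ->] ->]]]]; exists n.+1.
  by rewrite cats0 addSn.
- by move=> -> /= [v1 [v2 [-> [n ->] ->]]]; exists n; rewrite cats0 addnS.
- by move=> -> /= [v1 [v2 [-> -> ->]]]; exists 0; rewrite cats0.
- case=> be -> -> /= [_ -> [v1 [v2 [-> -> [_ -> ->]]]]].
  by rewrite /lin_word /= -!catA nseq_rcons.
- by case=> be -> -> /= ->.
Qed.

Lemma lin_grammar_complete u : block_language u -> ind_generates lin_grammar u.
Proof.
case=> n ->; apply/ind_generatesP; rewrite block_word3.
pose st := star (G := lin_grammar).
have pop m : st [:: inl (LPop, nseq m true ++ [:: false])]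
    (terminal_word _ (lin_word 0 m)).
  elim: m => [|m IH].
    apply: (@star_pop _ lin_grammar _ _ [::]); last exact: star_refl.
    by rewrite !inE eqxx ?orbT.
  apply: (@star_pop _ lin_grammar _ _ [:: inr (letter3 1); inl LPop; inr (letter3 2)]).
    by rewrite !inE eqxx ?orbT.
  have -> : lin_word 0 m.+1 = [:: letter3 1] ++ lin_word 0 m ++ [:: letter3 2].
    by rewrite /lin_word /= -!catA nseq_rcons.
  rewrite 2!terminal_word_cat.
  exact: (star_ctx (G := lin_grammar) [:: inr (letter3 1)] [:: inr (letter3 2)] IH).
have emit l m : st [:: inl (LEmit, nseq m true ++ [:: false])]
    (terminal_word _ (lin_word l (l + m))).
  elim: l m => [|l IH] m.
    apply: (@star_rewrite _ lin_grammar _ [:: inl LPop]); last exact: pop.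
    by rewrite !inE eqxx ?orbT.
  apply: (@star_rewrite _ lin_grammar _ [:: inr (letter3 0); inl LPush]).
    by rewrite !inE eqxx ?orbT.
  rewrite addSnnS; apply: (star_cons (G := lin_grammar)).
  apply: (@star_push _ lin_grammar _ LEmit true); last exact: (IH m.+1).
  by rewrite !inE eqxx ?orbT.
apply: (@star_push _ lin_grammar _ LEmit false).
  by rewrite !inE eqxx ?orbT.
by have := emit n 0; rewrite addn0.
Qed.

Lemma block3_LIN : IND_LIN (@block_language 3).
Proof.
exists lin_grammar; last first.
  by move=> u; split; [apply: lin_grammar_complete|apply: lin_grammar_sound].
by move=> p; rewrite !inE => /or4P[|||/or3P[]] /eqP->.
Qed.

Section FanOut.
Variable j : nat.

(* None pushes; Some i pops, emitting the letter i. Since false, the bottom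
   marker, may be pushed at any time, only the indices above the topmost false
   are counted. *)
Definition fan_prods : seq (production (option 'I_j) bool 'I_j) :=
  [:: Push None None true; Push None None false;
      Rewrite None [seq inl (Some i) | i <- enum 'I_j]] ++
  [seq Pop (Some i) true [:: inr i; inl (Some i)] | i <- enum 'I_j] ++
  [seq Pop (Some i) false [::] | i <- enum 'I_j].

Definition fan_grammar : indexed_grammar 'I_j :=
  @IndexedGrammar 'I_j (option 'I_j) bool fan_prods None.

Definition fan_denotes X (al : seq bool) (u : seq 'I_j) : Prop :=
  match X with
  | None => block_language u
  | Some i => u = nseq (index false al) i
  end.

Lemma fan_grammar_sound u : ind_generates fan_grammar u -> block_language u.
Proof.
move/ind_generatesP=> gu.
suff /(sem1 (G := fan_grammar) fan_denotes) :
  sem (G := fan_grammar) fan_denotes (ind_axiom fan_grammar) u by [].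
apply: sem_star (star_refl _) gu => p l A al r z v w v' pG e _ _ sz _.
move: pG e sz; rewrite mem_cat !inE mem_cat -!orbA => /or4P[|||/orP[]].
- by move/eqP=> -> /expandsE[<- ->] /= [v1 [v2 [-> bl ->]]]; rewrite cats0.
- by move/eqP=> -> /expandsE[<- ->] /= [v1 [v2 [-> bl ->]]]; rewrite cats0.
- move/eqP=> -> /expandsE[<- ->] sz; exists (index false al).
  move: sz; rewrite /block_word.
  by elim: (enum 'I_j) w => [|i s IH] w //= [v1 [v2 [-> -> /IH->]]].
- case/mapP=> i _ -> /expandsE[<- [be -> ->]] /= [_ -> [v1 [v2 [-> -> ->]]]].
  by rewrite cats0.
- by case/mapP=> i _ -> /expandsE[<- [be -> ->]] /= ->.
Qed.

Lemma fan_grammar_complete u : block_language u -> ind_generates fan_grammar u.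
Proof.
case=> n ->; apply/ind_generatesP.
pose st := star (G := fan_grammar).
have pop i m : st [:: inl (Some i, nseq m true ++ [:: false])]
    (terminal_word _ (nseq m i)).
  elim: m => [|m IH].
    apply: (@star_pop _ fan_grammar _ _ [::]); last exact: star_refl.
    by rewrite !mem_cat map_f ?orbT // mem_enum.
  apply: (@star_pop _ fan_grammar _ _ [:: inr i; inl (Some i)]).
    by rewrite !mem_cat map_f ?orbT // mem_enum.
  exact: (star_cons (G := fan_grammar)).
have push l m : st [:: inl (None, nseq m true ++ [:: false])]
    [:: inl (None, nseq (l + m) true ++ [:: false])].
  elim: l m => [|l IH] m; first exact: star_refl.
  apply: (@star_push _ fan_grammar _ None true).
    by rewrite mem_cat !inE eqxx ?orbT.
  by rewrite addSnnS; apply: (IH m.+1).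
apply: (@star_push _ fan_grammar _ None false).
  by rewrite mem_cat !inE eqxx ?orbT.
apply: star_trans (push n 0) _; rewrite addn0.
apply: (@star_rewrite _ fan_grammar _ [seq inl (Some i) | i <- enum 'I_j]).
  by rewrite mem_cat !inE eqxx ?orbT.
rewrite /block_word; elim: (enum 'I_j) => [|i s IH]; first exact: star_refl.
rewrite /= terminal_word_cat.
exact: (star_cat (G := fan_grammar) (pop i n) IH).
Qed.

(** The number of occurrences of [None] is a potential: the only production that can be special
    removes one and creates none, no other production increases their number, and the axiom has
    one. *)
Lemma fan_grammar_one_special : one_special fan_grammar.
Proof.
pose starts (x : sentential (option 'I_j) bool 'I_j) :=
  count (fun e => if e is inl (None, _) then true else false) x.
have starts_cat x y : starts (x ++ y) = starts x + starts y by exact: count_cat.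
move=> d [u [dd _]].
suff bnd x : derivation (G := fan_grammar) x d ->
    count (fun s => special s.1) d <= starts x by exact: bnd dd.
elim: d x {dd} => [|[p y] d IH] x //= [pG app /IH].
have [l [r [A [al [z [-> ey e]]]]]] := (appliesP (G := fan_grammar) _ _ _).1 app.
rewrite {}ey -cat1s !starts_cat => le.
apply: leq_trans (leq_add (leqnn _) le) _.
rewrite addnCA leq_add2l addnA leq_add2r.
move: pG; rewrite mem_cat !inE mem_cat -!orbA => /or4P[|||/orP[]].
- by move/eqP=> ep; move: e; rewrite ep => /expandsE[<- ->].
- by move/eqP=> ep; move: e; rewrite ep => /expandsE[<- ->].
- move/eqP=> ep; move: e; rewrite ep => /expandsE[<- ->].
  rewrite (_ : starts _ = 0) ?addn0; first by case: special.
  by elim: (enum 'I_j).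
- by case/mapP=> i _ ep; move: e; rewrite ep => /expandsE[<- [be _ ->]].
- by case/mapP=> i _ ep; move: e; rewrite ep => /expandsE[<- [be _ ->]].
Qed.

Lemma block_UFIN1 : IND_UFIN1 (@block_language j).
Proof.
exists fan_grammar; first exact: fan_grammar_one_special.
by move=> u; split; [apply: fan_grammar_complete|apply: fan_grammar_sound].
Qed.

End FanOut.

(** * Inclusions between the indexed families *)

Lemma LIN_UFIN1 : subfamily IND_LIN IND_UFIN1.
Proof.
move=> T L [G lin LG]; exists G => // d [u [dd _]].
suff -> : count (fun s => special s.1) d = 0 by [].
elim: d (ind_axiom G) dd => [|[p y] d IH] x //= [pG _ /IH->].
by rewrite addn0 /special ltnNge lin.
Qed.

Lemma UFIN1_UFIN : subfamily IND_UFIN1 IND_UFIN.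
Proof.
move=> T L [G one LG]; exists G => //.
pose R := (max_rhs G).+1; exists R.+1 => // d sd.
have := one d sd; case: sd => u [dd _]; rewrite /index_at_most /forms => le1.
(* [c] counts the special productions applied before [x]; only these can add variables, each of them
   at most [R]. *)
suff bnd x c : derivation x d -> num_vars x <= c * R + 1 ->
    c + count (fun s => special s.1) d <= 1 ->
    all (fun x => num_vars x <= R.+1) (x :: [seq s.2 | s <- d]).
  by apply: (bnd _ 0).
elim: d x c {dd le1} => [|[p y] d IH] x c.
  by rewrite /= addn0 andbT => _ nx c1; apply: leq_trans nx _; nia.
case=> pG /appliesP[l [r [A [al [z [ex ey e]]]]]] dy nx /= cd.
rewrite (_ : num_vars x <= R.+1); last by nia.
apply: (IH y (c + special p)) => //; last by rewrite -addnA.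
have hz : num_vars z <= if special p then R else 1.
  have := rhs_size_max pG; rewrite /R /special.
  case: e {ex ey pG cd} => [B nu b|B C f b|B f nu b] //=;
  by rewrite num_vars_attach -num_vars_letters; case: ltnP; lia.
by move: nx cd hz; rewrite ex ey !num_vars_cat /=; case: special; nia.
Qed.

Lemma UFIN_FIN : subfamily IND_UFIN IND_FIN.
Proof.
move=> T L [G [k k1 ufin] LG]; exists G => //; exists k => // u [d du].
by exists d => //; apply: ufin; exists u.
Qed.

(** * Triangular numbers *)

Fixpoint triangular n := if n is m.+1 then n + triangular m else 0.

Definition triangular_language : language unit := fun u =>
  exists n, size u = triangular n.

Lemma triangular_ge n : n <= triangular n.
Proof. by elim: n => //= n; lia. Qed.

Lemma triangular_mono : {homo triangular : m n / m <= n}.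
Proof. by move=> m n /subnK <-; elim: (n - m) => //= d; lia. Qed.

(** The triangular number following [triangular n] is larger by [n.+1]. *)
Lemma triangular_gap m n d : triangular m = triangular n + d -> d <= n -> d = 0.
Proof.
move=> e dn; have [le|lt] := leqP m n; first by have := triangular_mono le; lia.
by have := triangular_mono lt; rewrite /=; lia.
Qed.

Lemma triangular_not_UFIN : ~ IND_UFIN triangular_language.
Proof.
case=> G [k k1 ufin] LG.
have [D pump] := @pumping _ G k unit (fun=> tt).
(* The exchange adds between 1 and [D] letters, too few to cross the gap above [triangular D.+1]. *)
pose u := nseq (triangular D.+1) tt.
have bnd A B f (_ : Push A B f \in ind_prods G) := ufin.
have gu : ind_generates G u by apply/LG; exists D.+1; rewrite size_nseq.
have Du : D < size u by rewrite size_nseq triangular_ge.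
have [s1 [s2 [u' [[_ D1 _] [_ D2 _] _ lt12 [/LG[n e] cnt]]]]] :=
  pump u (yields_generates bnd gu) Du.
have := cnt predT; rewrite !count_predT e size_nseq; move: D1 D2 lt12.
move: (size (letters s1)) (size (letters s2)) => d1 d2 _ D2 lt12 en.
have /triangular_gap : triangular n = triangular D.+1 + (d2 - d1) by lia.
by lia.
Qed.

(* None pushes, Some true emits the height of its stack and Some false the sum
   of all heights up to the height of its stack. *)
Definition tri_prods : seq (production (option bool) bool unit) :=
  [:: Push None None true; Push None None false;
      Rewrite None [:: inl (Some false)];
      Pop (Some false) true [:: inr tt; inl (Some true); inl (Some false)];
      Pop (Some false) false [::];
      Pop (Some true) true [:: inr tt; inl (Some true)];
      Pop (Some true) false [::]].

Definition tri_grammar : indexed_grammar unit :=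
  @IndexedGrammar unit (option bool) bool tri_prods None.

Definition tri_denotes X (al : seq bool) (u : seq unit) : Prop :=
  match X with
  | None => triangular_language u
  | Some true => size u = index false al
  | Some false => size u = triangular (index false al)
  end.

Lemma tri_grammar_sound u : ind_generates tri_grammar u -> triangular_language u.
Proof.
move/ind_generatesP=> gu.
suff /(sem1 (G := tri_grammar) tri_denotes) :
  sem (G := tri_grammar) tri_denotes (ind_axiom tri_grammar) u by [].
apply: sem_star (star_refl _) gu => p l A al r z v w v' pG e _ _ sz _.
move: pG e sz; rewrite !inE => /or4P[|||/or4P[]] /eqP-> /expandsE[<-] /=.
- by move=> -> /= [v1 [v2 [-> bl ->]]]; rewrite cats0.
- by move=> -> /= [v1 [v2 [-> bl ->]]]; rewrite cats0.
- move=> -> /= [v1 [v2 [-> bl ->]]]; rewrite cats0.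
  by exists (index false al).
- case=> be -> -> /= [_ -> [v1 [v2 [-> s1 [v3 [v4 [-> s3 ->]]]]]]].
  by rewrite /= cats0 size_cat s1 s3 addSn.
- by case=> be -> -> /= ->.
- by case=> be -> -> /= [_ -> [v1 [v2 [-> s1 ->]]]]; rewrite /= cats0 s1.
- by case=> be -> -> /= ->.
Qed.

(* The heights are emitted one after the other, so that only two variables
   coexist. *)
Lemma tri_grammar_complete u : triangular_language u ->
  derives (G := tri_grammar) (fun x => num_vars x <= 2)
    (ind_axiom tri_grammar) (terminal_word _ u).
Proof.
case=> n su; have {su} -> : u = nseq (triangular n) tt.
  by rewrite -su; apply/all_pred1P/allP=> -[].
pose der k := derives (G := tri_grammar) (fun x => num_vars x <= k).
have count_stack m : der 1 [:: inl (Some true, nseq m true ++ [:: false])]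
    (terminal_word _ (nseq m tt)).
  elim: m => [|m IH].
    apply: (@derives_expand _ tri_grammar _ (Pop (Some true) false [::]) _ _ [::]) => //.
    - exact: (@ExpandPop _ tri_grammar).
    - exact: DerivesRefl.
  apply: (@derives_expand _ tri_grammar _ (Pop (Some true) true
    [:: inr tt; inl (Some true)])) => //.
  - exact: (@ExpandPop _ tri_grammar).
  - have := derives_cat (G := tri_grammar) (Q' := fun x => num_vars x <= 1)
      (l := [:: inr tt]) (r := [::]) _ IH.
    by rewrite !cats0; apply=> z; rewrite cats0.
have sum_stack m : der 2 [:: inl (Some false, nseq m true ++ [:: false])]
    (terminal_word _ (nseq (triangular m) tt)).
  elim: m => [|m IH].
    apply: (@derives_expand _ tri_grammar _ (Pop (Some false) false [::]) _ _ [::]) => //.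
    - exact: (@ExpandPop _ tri_grammar).
    - exact: DerivesRefl.
  apply: (@derives_expand _ tri_grammar _ (Pop (Some false) true
    [:: inr tt; inl (Some true); inl (Some false)])) => //.
  - exact: (@ExpandPop _ tri_grammar).
  - apply: derives_trans (derives_cat (G := tri_grammar) (l := [:: inr tt])
      (r := [:: inl (Some false, nseq m true ++ [:: false])]) _ (count_stack m)) _.
      by move=> z; rewrite !num_vars_cat /=; lia.
    rewrite (_ : nseq (triangular m.+1) tt = nseq m.+1 tt ++ nseq (triangular m) tt); last first.
      by rewrite -nseqD.
    rewrite terminal_word_cat catA.
    have := derives_cat (G := tri_grammar) (Q' := fun x => num_vars x <= 2)
      (l := terminal_word _ (nseq m.+1 tt)) (r := [::]) _ IH.
    rewrite !cats0; apply=> z.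
    by rewrite !num_vars_cat num_vars_terminal addn0.
have push l m : der 2 [:: inl (None, nseq m true ++ [:: false])]
    [:: inl (None, nseq (l + m) true ++ [:: false])].
  elim: l m => [|l IH] m; first exact: DerivesRefl.
  apply: (@derives_expand _ tri_grammar _ (Push None None true)) => //.
    exact: (@ExpandPush _ tri_grammar).
  by rewrite addSnnS; apply: (IH m.+1).
apply: (@derives_expand _ tri_grammar _ (Push None None false)) => //.
  exact: (@ExpandPush _ tri_grammar).
apply: derives_trans (push n 0) _; rewrite addn0.
apply: (@derives_expand _ tri_grammar _ (Rewrite None [:: inl (Some false)])) => //.
  exact: (@ExpandRewrite _ tri_grammar).
exact: sum_stack.
Qed.

Lemma triangular_FIN : IND_FIN triangular_language.
Proof.
exists tri_grammar.
  exists 2 => // u /tri_grammar_sound/tri_grammar_complete.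
  by case/derivesP=> d [dd lst all_d]; exists d.
move=> u; split; last exact: tri_grammar_sound.
case/tri_grammar_complete/derivesP=> d [dd lst _].
by exists d.
Qed.

(** * Pushdown simulation of context-free grammars *)

Section PushdownGrammar.
Variables (T : finType) (G : cf_grammar T).

Definition symbol := option (cf_var G + T).

(** Long enough for every right-hand side, and 2 for the initial word made of the start variable and
    the bottom marker. *)
Definition pushdown_size := \max_(q <- cf_prods G) size q.2 + 2.

Definition pushdown_var := pushdown_size.-bseq symbol.

Definition to_push (s : seq symbol) : pushdown_var := insub_bseq _ s.

(* The variable b still has to push the word b, last symbol first; the empty
   one pops. The index None marks the bottom of the stack. *)
Definition pushdown_prods : seq (production pushdown_var symbol T) :=
  [seq Push q.1.1 q.1.2 q.2 | q <- enum {: pushdown_var * pushdown_var * symbol}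
     & val q.1.1 == rcons (val q.1.2) q.2] ++
  [seq Pop (to_push [::]) (Some (inr a)) [:: inr a; inl (to_push [::])] | a <- enum T] ++
  [seq Pop (to_push [::]) (Some (inl q.1)) [:: inl (to_push (map Some q.2))]
     | q <- cf_prods G] ++
  [:: Pop (to_push [::]) None [::]].

Definition pushdown_grammar : indexed_grammar T :=
  @IndexedGrammar T pushdown_var symbol pushdown_prods
    (to_push [:: Some (inl (cf_start G)); None]).

Lemma val_to_push s : size s <= pushdown_size -> val (to_push s) = s.
Proof. by move=> le; rewrite val_insubd le. Qed.

Lemma val_to_push_rhs A nu : (A, nu) \in cf_prods G ->
  val (to_push (map Some nu)) = map Some nu.
Proof.
move=> AP; apply: val_to_push; rewrite size_map /pushdown_size.
by apply: leq_trans (leq_addr _ _); rewrite (leq_bigmax_seq (F := fun q => size q.2) _ AP).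
Qed.

(** Runs of the usual top-down pushdown automaton, with the unread part of a leftmost derivation on
    the stack. Whatever lies below the first [None] is discarded. *)
Inductive accepts : seq symbol -> seq T -> Prop :=
| AcceptsBottom al : accepts (None :: al) [::]
| AcceptsTerminal a al u of accepts al u : accepts (Some (inr a) :: al) (a :: u)
| AcceptsVar A nu al u of (A, nu) \in cf_prods G &
    accepts (map Some nu ++ al) u : accepts (Some (inl A) :: al) u.

Lemma accepts_cf s u : accepts (map Some s ++ [:: None]) u ->
  clos_refl_trans _ (cf_step (G:=G)) s (terminal_word _ u).
Proof.
move eal : (_ ++ _) => al acc.
elim: acc s eal => {al u} [al|a al u _ IH|A nu al u AP _ IH] [|x s] //=.
- by move=> _; apply: rt_refl.
- case=> -> /IH; elim=> [y z [l r A nu AP]|y|x' y z _ IH1 _ IH2].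
  + exact: rt_step (@CFStep _ G (inr a :: l) r A nu AP).
  + exact: rt_refl.
  + exact: rt_trans IH2.
- case=> -> es; apply: rt_trans (rt_step _ _ _ _ (@CFStep _ G [::] s A nu AP)) _.
  by apply: IH; rewrite -es cat0s map_cat catA.
Qed.

(** Derivation steps may occur anywhere, whereas acceptance works leftmost. Acceptance is therefore
    shown to survive undoing a step at any position, going backwards from the terminal word. *)
Lemma cf_accepts s u : clos_refl_trans _ (cf_step (G:=G)) s (terminal_word _ u) ->
  accepts (map Some s ++ [:: None]) u.
Proof.
move=> /(clos_rt_rt1n _ _ _ _); move et : (terminal_word _ u) => t d.
elim: d et => {s t} [s <-|s t t' st _ IH et].
  by elim: u => [|a u IH] /=; constructor.
case: st (IH et) => l r A nu AP; rewrite !map_cat -!catA map_cons.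
set be := map Some r ++ _ => /=; move eal : (_ ++ _ ++ _) => al acc.
(* The accepting run is followed until the prefix [l] is used up; there, one expansion of [A] is
   inserted. *)
elim: acc l eal {IH} => {al} [al|a al v acc IH|B mu al v BP acc IH] [|x l] //=.
- by move=> e; apply: AcceptsVar AP _; rewrite e; constructor.
- by move=> e; apply: AcceptsVar AP _; rewrite e; constructor.
- by case=> -> e; apply: AcceptsTerminal; apply: IH.
- by move=> e; apply: AcceptsVar AP _; rewrite e; apply: AcceptsVar BP acc.
- case=> -> e; apply: (AcceptsVar BP); rewrite catA -map_cat; apply: IH.
  by rewrite map_cat -catA e.
Qed.

Definition pushdown_denotes (b : pushdown_var) (al : seq symbol) u :=
  accepts (val b ++ al) u.

Lemma pushdown_sound u : ind_generates pushdown_grammar u -> cf_generates G u.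
Proof.
move/ind_generatesP=> gu.
suff /(sem1 (G := pushdown_grammar) pushdown_denotes) :
    sem (G := pushdown_grammar) pushdown_denotes (ind_axiom pushdown_grammar) u.
  rewrite /pushdown_denotes /= val_to_push ?cats0 /pushdown_size ?leq_addl //.
  exact: (accepts_cf (s := [:: _])).
apply: sem_star (star_refl _) gu => p l A al r z v w v' pG e _ _ sz _.
have nilE : val (to_push [::]) = [::] by apply: val_to_push.
move: pG e sz; rewrite !mem_cat => /or4P[].
- case/mapP=> -[[b b'] x]; rewrite mem_filter /= => /andP[/eqP eb _] ->.
  move=> /expandsE[<- ->] /= [v1 [v2 [-> acc ->]]]; rewrite cats0.
  by rewrite /pushdown_denotes /= eb cat_rcons.
- case/mapP=> a _ -> /expandsE[<- [be -> ->]] /= [_ -> [v1 [v2 [-> acc ->]]]].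
  rewrite cats0; move: acc; rewrite /pushdown_denotes nilE.
  exact: AcceptsTerminal.
- case/mapP=> -[B nu] BP -> /expandsE[<- [be -> ->]] /= [v1 [v2 [-> acc ->]]].
  rewrite cats0; move: acc; rewrite /pushdown_denotes nilE (val_to_push_rhs BP).
  exact: AcceptsVar BP.
- rewrite inE => /eqP-> /expandsE[<- [be -> ->]] /= ->.
  by rewrite /pushdown_denotes nilE; apply: AcceptsBottom.
Qed.

Lemma pushdown_star_push (b : pushdown_var) al :
  star (G := pushdown_grammar)
    [:: inl (b, al)] [:: inl (to_push [::], val b ++ al)].
Proof.
move es : (val b) => s; elim/last_ind: s b al es => [|s x IH] b al es.
  rewrite (_ : b = to_push [::]); first exact: star_refl.
  by apply: val_inj; rewrite es val_to_push.
have les : size s <= pushdown_size.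
  by have := size_bseq b; rewrite -[size b]/(size (val b)) es size_rcons => /ltnW.
apply: (@star_push _ pushdown_grammar _ (to_push s) x).
  rewrite mem_cat; apply/orP; left; apply/mapP; exists (b, to_push s, x) => //.
  by rewrite mem_filter mem_enum /= es val_to_push ?eqxx.
by rewrite cat_rcons; apply: IH; rewrite val_to_push.
Qed.

Lemma pushdown_complete u : cf_generates G u -> ind_generates pushdown_grammar u.
Proof.
move=> /(cf_accepts (s := [:: _])) /= acc; apply/ind_generatesP.
apply: star_trans (pushdown_star_push _ _) _.
rewrite cats0 val_to_push ?leq_addl //=.
elim: acc => [al|a al v _ IH|A nu al v AP _ IH].
- apply: (@star_pop _ pushdown_grammar _ _ [::]); last exact: star_refl.
  by rewrite !mem_cat inE eqxx !orbT.
- apply: (@star_pop _ pushdown_grammar _ _ [:: inr a; inl (to_push [::])]).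
    by rewrite !mem_cat map_f ?orbT // mem_enum.
  exact: (star_cons (G := pushdown_grammar)).
- apply: (@star_pop _ pushdown_grammar _ _ [:: inl (to_push (map Some nu))]).
    rewrite !mem_cat; apply/or4P; apply: Or43.
    by apply/mapP; exists (A, nu).
  apply: star_trans (pushdown_star_push _ _) _.
  by rewrite (val_to_push_rhs AP).
Qed.

Lemma pushdown_linear : linear_indexed pushdown_grammar.
Proof.
move=> p; rewrite !mem_cat => /or4P[].
- by case/mapP=> q _ ->.
- by case/mapP=> a _ ->.
- by case/mapP=> q _ ->.
- by rewrite inE => /eqP->.
Qed.

End PushdownGrammar.

Lemma CFL_LIN : subfamily CFL IND_LIN.
Proof.
move=> T L [G LG]; exists (pushdown_grammar G); first exact: pushdown_linear.
by move=> u; rewrite LG; split; [apply: pushdown_complete|apply: pushdown_sound].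
Qed.

(** * Assembling the chain from the inclusions and the separating languages *)

Theorem corollary30 :
  proper_subfamily CFL IND_LIN /\
  proper_subfamily IND_LIN IND_UFIN1 /\
  subfamily IND_UFIN1 IND_UFIN /\
  proper_subfamily IND_UFIN IND_FIN.
Proof.
split; [|split; [|split]].
- split; first exact: CFL_LIN.
  exists 'I_3, (@block_language 3); split; [exact: block3_LIN|exact: CFL_blocks].
- split; first exact: LIN_UFIN1.
  exists 'I_5, (@block_language 5); split; [exact: block_UFIN1|exact: LIN_blocks].
- exact: UFIN1_UFIN.
- split; first exact: UFIN_FIN.
  exists unit, triangular_language.
  by split; [exact: triangular_FIN|exact: triangular_not_UFIN].
Qed.
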